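(* Let $G$ be the complement of the line graph of a graph $H$. Then $\chi(G)=v(H)-2$ if and only if the complement graph $\overline{H}$ is a collection of vertex-disjoint cycles and paths, in which each cycle is of length at least $5$.
   Context: Graphs are finite and simple. $v(H)$ is the number of vertices of $H$. The complement of the line graph of a graph $H$ is the graph whose vertices are the edges of $H$, two of them being adjacent exactly when they are disjoint as edges of $H$. $\chi$ is the chromatic number. $\overline{H}$ is the graph on the same vertex set as $H$ in which two distinct vertices are adjacent exactly when they are not adjacent in $H$. A path may be reduced to a single vertex (so that, for instance, the case where $H$ is a complete graph is included).
   Formalization: The equivalence fails when H is a complete graph on at most 2 vertices (e.g. K_2: χ(G)=1, v(H)-2=0) and when H is two disjoint edges (χ(G)=2=v(H)-2 but the complement is a 4-cycle); exactly these four graphs are excluded. *)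

(* Defs.v *)
From HB Require Import structures.
From mathcomp Require Import all_boot.

Set Implicit Arguments.
Unset Strict Implicit.
Unset Printing Implicit Defensive.

Record sgraph := SGraph {
  vertex :> finType;
  adj : rel vertex;
  adj_sym : symmetric adj;
  adj_irrefl : irreflexive adj }.

Definition isomorphic (G H : sgraph) : Prop :=
  exists2 f : G -> H, bijective f & forall x y, adj (f x) (f y) = adj x y.

Section Complement.
Variable H : sgraph.

Definition compl_adj (x y : H) : bool :=
  (x != y) && ~~ adj x y.

Fact compl_adj_sym : symmetric compl_adj.
Proof. by move=> x y; rewrite /compl_adj /= eq_sym adj_sym. Qed.

Fact compl_adj_irrefl : irreflexive compl_adj.
Proof. by move=> x; rewrite /compl_adj /= eqxx. Qed.

Definition complement := SGraph compl_adj_sym compl_adj_irrefl.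

End Complement.

Section LineGraph.
Variable H : sgraph.

Definition edges : {set {set H}} :=
  [set [set x; y] | x in H, y in H & adj x y].

Definition edge := {e : {set H} | e \in edges}.

Definition line_adj (e f : edge) : bool :=
  (e != f) && ~~ [disjoint val e & val f].

Fact line_adj_sym : symmetric line_adj.
Proof. by move=> e f; rewrite /line_adj /= eq_sym disjoint_sym. Qed.

Fact line_adj_irrefl : irreflexive line_adj.
Proof. by move=> e; rewrite /line_adj /= eqxx. Qed.

Definition line_graph := SGraph line_adj_sym line_adj_irrefl.

Lemma adj_complement_line_graph (e f : complement line_graph) :
  adj e f = [disjoint val e & val f].
Proof.
rewrite /= /compl_adj /= /line_adj /=; case: eqVneq => [<-|_]; last by rewrite negbK.
case/imset2P: (valP e) => x y _ _ ->.
by apply/esym/negbTE/pred0Pn; exists x; rewrite /= !inE eqxx.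
Qed.

End LineGraph.

Section Induced.
Variables (H : sgraph) (S : {set H}).

Definition induced_adj : rel {x | x \in S} := relpre val (@adj H).

Fact induced_adj_sym : symmetric induced_adj.
Proof. by move=> x y; apply: adj_sym. Qed.

Fact induced_adj_irrefl : irreflexive induced_adj.
Proof. by move=> x; apply: adj_irrefl. Qed.

Definition induced := SGraph induced_adj_sym induced_adj_irrefl.

End Induced.

Section StandardGraphs.
Variable n : nat.

Definition complete_adj (i j : 'I_n) : bool :=
  i != j.

Fact complete_adj_sym : symmetric complete_adj.
Proof. by move=> i j; rewrite /complete_adj /= eq_sym. Qed.

Fact complete_adj_irrefl : irreflexive complete_adj.
Proof. by move=> i; rewrite /complete_adj /= eqxx. Qed.

Definition complete_graph := SGraph complete_adj_sym complete_adj_irrefl.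

Definition path_adj (i j : 'I_n) : bool :=
  (i.+1 == j) || (j.+1 == i).

Fact path_adj_sym : symmetric path_adj.
Proof. by move=> i j; rewrite /path_adj /= orbC. Qed.

Fact path_adj_irrefl : irreflexive path_adj.
Proof. by move=> i; rewrite /path_adj /= orbb gtn_eqF. Qed.

Definition path_graph := SGraph path_adj_sym path_adj_irrefl.

(* [ordS i] is i + 1 mod n; this is the n-cycle only when 3 <= n. *)
Definition cycle_adj (i j : 'I_n) : bool :=
  (i != j) && ((ordS i == j) || (ordS j == i)).

Fact cycle_adj_sym : symmetric cycle_adj.
Proof. by move=> i j; rewrite /cycle_adj /= eq_sym orbC. Qed.

Fact cycle_adj_irrefl : irreflexive cycle_adj.
Proof. by move=> i; rewrite /cycle_adj /= eqxx. Qed.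

Definition cycle_graph := SGraph cycle_adj_sym cycle_adj_irrefl.

End StandardGraphs.

(* The path with n vertices; n = 1 is allowed. *)
Definition is_path_graph (G : sgraph) : Prop :=
  exists2 n, 0 < n & isomorphic G (path_graph n).

Definition is_cycle_graph_ge (l : nat) (G : sgraph) : Prop :=
  exists2 n, l <= n & isomorphic G (cycle_graph n).

(* The blocks of P are the vertex sets of the members of the collection.  Since
   the collection makes up the whole graph, no edge joins two blocks and each
   member is the subgraph induced on its block. *)
Definition disjoint_cycles_and_paths (l : nat) (G : sgraph) : Prop :=
  exists P : {set {set G}},
    [/\ partition P [set: G],
        forall x y : G, adj x y -> pblock P x = pblock P y
      & forall S : {set G}, S \in P ->
          is_path_graph (induced S) \/ is_cycle_graph_ge l (induced S)].

Section ChromaticNumber.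
Variable G : sgraph.

Definition colorable (k : nat) : bool :=
  [exists c : {ffun G -> 'I_k}, forall x, forall y, adj x y ==> (c x != c y)].

Fact colorable_card : exists k, colorable k.
Proof.
exists #|G|; apply/existsP; exists [ffun x => enum_rank x].
apply/forallP=> x; apply/forallP=> y; apply/implyP; rewrite !ffunE.
by apply: contraTneq => /enum_rank_inj ->; rewrite adj_irrefl.
Qed.

Definition chromatic_number : nat := ex_minn colorable_card.

End ChromaticNumber.

(* Main.v *)
Require Import Defs.
From mathcomp Require Import all_boot.
From mathcomp Require Import zify.

(* A colour class is a family of pairwise intersecting edges, i.e. a star or the edges inside a
   3-set, so the chromatic number is the least number of stars and 3-sets covering the edges of H.
   Let n = v(H) and let K be the complement of H. If K has a vertex x with three neighbours
   a, b, c, then the stars at the n - 4 other vertices and the 3-set abc are a cover; if K has a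
   triangle, then the n - 3 other stars are; if K has a square acbd and e is a fifth vertex, then
   the n - 5 other stars and the 3-sets eab, ecd are. Conversely, suppose that K has none of these,
   and consider a cover by stars and t 3-sets; let R, of size m, be the set of vertices that are
   not centres of the stars, and suppose t <= m - 3. Each vertex of R has at least m - 3 neighbours
   in R, hence is in at least (m - 3)/2 of the 3-sets; double counting leaves m = 3, when R is a
   triangle of K, and m = 5, when two 3-sets cover all of R and their differences span a square
   of K. *)

Set Implicit Arguments.
Unset Strict Implicit.
Unset Printing Implicit Defensive.

(** * Colourings as covers by stars and 3-sets *)

Lemma chromatic_number_le (G : sgraph) k : colorable G k -> chromatic_number G <= k.
Proof. by rewrite /chromatic_number; case: ex_minnP => m _; apply. Qed.

Lemma colorable_chromatic_number (G : sgraph) : colorable G (chromatic_number G).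
Proof. by rewrite /chromatic_number; case: ex_minnP. Qed.

Section Edges.
Variable H : sgraph.

Lemma edgesP (e : {set H}) :
  reflect (exists x y, adj x y /\ e = [set x; y]) (e \in edges H).
Proof.
apply: (iffP imset2P) => [[x y _]|[x [y [xy ->]]]].
  by rewrite inE => /andP[_ xy] ->; exists x, y.
by exists x y; rewrite // inE xy andbT.
Qed.

Lemma card_edge (e : {set H}) : e \in edges H -> #|e| = 2.
Proof.
case/edgesP=> x [y [xy ->]]; rewrite cards2.
by case: eqVneq xy => // ->; rewrite adj_irrefl.
Qed.

End Edges.

Lemma setI_neq0_of_subset (T : finType) (A B C : {set T}) :
  A \subset C -> B \subset C -> #|C| < #|A| + #|B| -> ~~ [disjoint A & B].
Proof.
move=> sAC sBC ltC; apply/negP => /disjoint_setI0 I0.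
have := subset_leq_card (introT subUsetP (conj sAC sBC)).
by rewrite cardsU I0 cards0 subn0 leqNgt ltC.
Qed.

(** If neither end of a pair [xy] lies in all the pairs, some [f] misses [x] and some [g] misses
    [y]. They are [uy] and [ux] for a third point [u], and a pair meeting all three sides of the
    triangle [xyu] lies inside it. *)
Lemma intersecting_pairs (T : finType) (F : {set {set T}}) :
  {in F, forall e : {set T}, #|e| = 2} ->
  {in F &, forall e f : {set T}, ~~ [disjoint e & f]} ->
  (exists z, {in F, forall e : {set T}, z \in e}) \/
  (exists2 U : {set T}, #|U| <= 3 & {in F, forall e : {set T}, e \subset U}).
Proof.
move=> F2 FI.
have meet (e f : {set T}) : e \in F -> f \in F -> exists2 x, x \in e & x \in f.
  by move=> eF fF; have /pred0Pn[x /andP[]] := FI _ _ eF fF; exists x.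
case: (set_0Vmem F) => [->|[e eF]].
  by right; exists set0; rewrite ?cards0 // => f; rewrite inE.
have /eqP/cards2P[x [y [xy def_e]]] := F2 _ eF.
have [/forall_inP|] := boolP [forall f in F, x \in f]; first by move=> ?; left; exists x.
have [/forall_inP|] := boolP [forall f in F, y \in f]; first by move=> ?; left; exists y.
case/forall_inPn => g gF yg; case/forall_inPn => f fF xf.
have [yf xg] : y \in f /\ x \in g.
  have [u1] := meet _ _ eF fF; have [u2] := meet _ _ eF gF.
  rewrite def_e !inE => /orP[]/eqP-> Hg; last by rewrite Hg in yg.
  by case/orP=> /eqP-> // Hf; rewrite Hf in xf.
have [u uf ug] := meet _ _ fF gF.
have ux : u != x by apply: contraNneq xf => <-.
have uy : u != y by apply: contraNneq yg => <-.
have pair (h : {set T}) a b : h \in F -> a \in h -> b \in h -> a != b -> h = [set a; b].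
  move=> hF ah bh ab; apply/eqP; rewrite eq_sym eqEcard subUset !sub1set ah bh /=.
  by rewrite cards2 ab (F2 _ hF).
have def_f := pair f u y fF uf yf uy; have def_g := pair g u x gF ug xg ux.
right; exists [set x; y; u].
  by rewrite (leq_trans (leq_card_setU _ _)) // cards1 cards2 xy.
move=> h hF.
have [p] := meet _ _ eF hF; have [q] := meet _ _ fF hF; have [r] := meet _ _ gF hF.
have sub a b : a != b -> a \in [set x; y; u] -> b \in [set x; y; u] -> a \in h -> b \in h ->
    h \subset [set x; y; u].
  by move=> ab aU bU ah bh; rewrite (pair h a b) // subUset !sub1set aU.
rewrite def_f def_g def_e => /set2P[]-> rh /set2P[]-> qh /set2P[]-> ph;
  first [ by apply: (sub u x); rewrite // !inE ?eqxx ?orbT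
        | by apply: (sub u y); rewrite // !inE ?eqxx ?orbT
        | by apply: (sub x y); rewrite // !inE ?eqxx ?orbT ].
Qed.

(** [S] holds the centres of the stars and [Ts] the 3-sets, so only edges with both ends outside [S]
    have to lie in a member of [Ts]. *)
Lemma colorable_cover (H : sgraph) k :
  colorable (complement (line_graph H)) k <->
  exists (S : {set H}) (Ts : seq {set H}),
    [/\ #|S| + size Ts <= k, {in Ts, forall T : {set H}, #|T| <= 3} &
        {in ~: S &, forall x y, adj x y -> exists2 T, T \in Ts & (x \in T) && (y \in T)}].
Proof.
split.
  case/existsP=> c /forallP c_ok.
  pose cls i := [set val e | e : complement (line_graph H) & c e == i].
  have clsP i : {in cls i, forall e : {set H}, #|e| = 2}.
    by move=> e /imsetP[e' _ ->]; apply: card_edge (valP e').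
  have clsI i : {in cls i &, forall e f : {set H}, ~~ [disjoint e & f]}.
    move=> _ _ /imsetP[e + ->] /imsetP[f + ->]; rewrite !inE => /eqP ce /eqP cf.
    rewrite -adj_complement_line_graph; apply/negP => ef.
    by have /forallP/(_ f)/implyP/(_ ef) := c_ok e; rewrite ce cf eqxx.
  (* A colour class with a common vertex becomes the star at [z i], any other class becomes the set
     [U i]; each colour is thus counted once. *)
  pose z i := [pick z | [forall e in cls i, z \in e]].
  pose U i := odflt set0 [pick U : {set H} | (#|U| <= 3) && [forall e in cls i, e \subset U]].
  have U3 i : #|U i| <= 3.
    by rewrite /U; case: pickP => [? /andP[]|_] //=; rewrite cards0.
  exists [set x in pmap z (enum 'I_k)], [seq U i | i <- enum 'I_k & ~~ z i]; split.
  - rewrite size_map size_filter cardsE (leq_trans (leq_add (card_size _) (leqnn _))) //.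
    by rewrite size_pmap (count_predC z) size_enum_ord.
  - by move=> _ /mapP[i _ ->].
  move=> x y; rewrite !inE => xS yS xy.
  have xyE : [set x; y] \in edges H by apply/edgesP; exists x, y.
  pose e : complement (line_graph H) := Sub [set x; y] xyE.
  have eC : [set x; y] \in cls (c e) by apply/imsetP; exists e; rewrite ?inE.
  have zN : ~~ z (c e).
    apply/negP; case def_z: (z (c e)) => [w|//] _.
    have wS : w \in pmap z (enum 'I_k) by rewrite mem_pmap -def_z map_f ?mem_enum.
    move: def_z; rewrite /z; case: pickP => // v /forall_inP/(_ _ eC) ve [E].
    by move: ve; rewrite E => /set2P[]E'; move: xS yS; rewrite -E' wS.
  exists (U (c e)); first by apply: map_f; rewrite mem_filter zN mem_enum.
  move: zN; rewrite /z /U; case: pickP => // zN _.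
  have [[w /forall_inP]|[V V3 /forall_inP VU]] := intersecting_pairs (clsP (c e)) (clsI (c e)).
    by rewrite zN.
  case: pickP => [W /andP[_ /forall_inP/(_ _ eC)]|/(_ V)]; last by rewrite V3 VU.
  by rewrite subUset !sub1set.
case=> S [Ts [le_k T3 cov]].
(* An edge is coloured by the position in [L] of the first family that contains it. *)
pose L := [seq [set e : {set H} | z \in e] | z <- enum S] ++ [seq powerset T | T <- Ts].
have sL : size L <= k by rewrite size_cat !size_map -cardE.
pose col (e : {set H}) := find (fun F : {set {set H}} => e \in F) L.
have hasL e : e \in edges H -> has (fun F : {set {set H}} => e \in F) L.
  case/edgesP=> x [y [xy ->]]; apply/hasP.
  have star z : z \in S -> z \in [set x; y] -> exists2 F : {set {set H}}, F \in L & [set x; y] \in F.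
    move=> zS ze; exists [set e : {set H} | z \in e]; last by rewrite inE.
    rewrite mem_cat; apply/orP; left.
    by apply/mapP; exists z; rewrite ?mem_enum.
  case: (boolP (x \in S)) => xS; first by apply: (star x); rewrite ?inE ?eqxx.
  case: (boolP (y \in S)) => yS; first by apply: (star y); rewrite ?inE ?eqxx ?orbT.
  have [||T TT xyT] := cov x y _ _ xy; rewrite ?inE //.
  exists (powerset T); last by rewrite powersetE subUset !sub1set.
  by rewrite mem_cat map_f ?orbT.
have colk (e : complement (line_graph H)) : col (val e) < k.
  by apply: leq_trans sL; rewrite -has_find hasL // (valP e).
apply/existsP; exists [ffun e => Ordinal (colk e)].
apply/forallP=> e; apply/forallP=> f; apply/implyP; rewrite !ffunE adj_complement_line_graph.
apply: contraTneq => /(congr1 val) /= ef.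
(* Edges of the same colour lie in the same member of [L]: they share a centre, or they are two
   pairs among at most three points and so meet. *)
have eF := nth_find set0 (hasL _ (valP e)); have fF := nth_find set0 (hasL _ (valP f)).
have := hasL _ (valP f); rewrite has_find => /(mem_nth set0).
rewrite /col in ef; rewrite ef in eF; rewrite mem_cat; move: eF fF.
set F := nth _ _ _ => eF fF /orP[]/mapP[z zS FE]; move: eF fF; rewrite FE !inE => eF fF.
  by apply/pred0Pn; exists z; rewrite /= eF.
apply: setI_neq0_of_subset eF fF _.
by rewrite (card_edge (valP e)) (card_edge (valP f)) ltnS T3.
Qed.

(** * Local conditions satisfied by disjoint paths and long cycles *)

Section LocalProperties.
Variable G : sgraph.

Definition degree_le2 :=
  forall x a b c : G, adj x a -> adj x b -> adj x c -> [|| a == b, a == c | b == c].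

Definition triangle_free :=
  forall x y z : G, adj x y -> adj y z -> adj z x -> False.

(** The 4-cycle runs through [a], [c], [b], [d] in this order, with opposite pairs [a], [b] and [c],
    [d]; it may have chords. *)
Definition square_free :=
  forall a c b d : G, adj a c -> adj c b -> adj b d -> adj d a -> (a == b) || (c == d).

End LocalProperties.

Lemma adj_neq (G : sgraph) (x y : G) : adj x y -> x != y.
Proof. by apply: contraTneq => ->; rewrite adj_irrefl. Qed.

Lemma degree_le2_iso (G K : sgraph) : isomorphic G K -> degree_le2 K -> degree_le2 G.
Proof.
move=> [f /bij_inj fI fA] d2 x a b c; rewrite -!fA => xa xb xc.
by have := d2 _ _ _ _ xa xb xc; rewrite !(inj_eq fI).
Qed.

Lemma triangle_free_iso (G K : sgraph) : isomorphic G K -> triangle_free K -> triangle_free G.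
Proof. by move=> [f _ fA] t3 x y z; rewrite -!fA; apply: t3. Qed.

Lemma square_free_iso (G K : sgraph) : isomorphic G K -> square_free K -> square_free G.
Proof.
move=> [f /bij_inj fI fA] c4 a c b d; rewrite -!fA => ac cb bd da.
by have := c4 _ _ _ _ ac cb bd da; rewrite !(inj_eq fI).
Qed.

Lemma path_graph_local n :
  [/\ degree_le2 (path_graph n), triangle_free (path_graph n) & square_free (path_graph n)].
Proof.
split=> [x a b c|x y z|a c b d]; rewrite /= /path_adj -?val_eqE /=; lia.
Qed.

(** Replaces the successor modulo [n] by a case distinction at the wrap-around, which [lia] can
    handle. *)
Lemma cycle_adjE n (i j : 'I_n) : cycle_adj i j =
  (i != j) && [|| i.+1 == j, j.+1 == i, (i == 0 :> nat) && (j.+1 == n) | (j == 0 :> nat) && (i.+1 == n)].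
Proof.
have modE (k : 'I_n) : k.+1 %% n = if k.+1 == n then 0 else k.+1.
  by case: eqP => [->|?]; [rewrite modnn | rewrite modn_small //; have := ltn_ord k; lia].
rewrite /cycle_adj -!val_eqE /= !modE.
by have := ltn_ord i; have := ltn_ord j; case: ifP; case: ifP; lia.
Qed.

Lemma cycle_graph_local n : 5 <= n ->
  [/\ degree_le2 (cycle_graph n), triangle_free (cycle_graph n) & square_free (cycle_graph n)].
Proof.
move=> n5; split=> [x a b c|x y z|a c b d]; rewrite /= !cycle_adjE -?val_eqE /=.
- have := ltn_ord x; have := ltn_ord a; have := ltn_ord b; have := ltn_ord c; lia.
- have := ltn_ord x; have := ltn_ord y; have := ltn_ord z; lia.
- have := ltn_ord a; have := ltn_ord b; have := ltn_ord c; have := ltn_ord d; lia.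
Qed.

(** No edge leaves a block, so a triangle, a square, or a vertex with three neighbours lies in a
    single block, where the conditions are known. *)
Lemma disjoint_cycles_and_paths_local (G : sgraph) : disjoint_cycles_and_paths 5 G ->
  [/\ degree_le2 G, triangle_free G & square_free G].
Proof.
case=> P [/and3P[/eqP covP trivP _] adjP blockP].
have memP (x : G) : x \in pblock P x by rewrite mem_pblock covP inE.
have inP (x : G) : pblock P x \in P by rewrite pblock_mem // covP inE.
have local (x : G) : [/\ degree_le2 (induced (pblock P x)), triangle_free (induced (pblock P x))
    & square_free (induced (pblock P x))].
  have [[n _ iso]|[n n5 iso]] := blockP _ (inP x).
    have [? ? ?] := path_graph_local n.
    by split; [apply: degree_le2_iso iso _ | apply: triangle_free_iso iso _ | apply: square_free_iso iso _].
  have [? ? ?] := cycle_graph_local n5.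
  by split; [apply: degree_le2_iso iso _ | apply: triangle_free_iso iso _ | apply: square_free_iso iso _].
have nbr (x y z : G) : y \in pblock P x -> adj y z -> z \in pblock P x.
  by move=> /(same_pblock trivP) <- /adjP ->; apply: memP.
split=> [x a b c xa xb xc|x y z xy yz zx|a c b d ac cb bd da].
- have [d2 _ _] := local x.
  have aB := nbr _ _ _ (memP x) xa; have bB := nbr _ _ _ (memP x) xb.
  have cB := nbr _ _ _ (memP x) xc.
  exact: (d2 (exist _ x (memP x)) (exist _ a aB) (exist _ b bB) (exist _ c cB)).
- have [_ t3 _] := local x.
  have yB := nbr _ _ _ (memP x) xy; have zB := nbr _ _ _ yB yz.
  exact: (t3 (exist _ x (memP x)) (exist _ y yB) (exist _ z zB)).
- have [_ _ c4] := local a.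
  have cB := nbr _ _ _ (memP a) ac; have bB := nbr _ _ _ cB cb; have dB := nbr _ _ _ bB bd.
  exact: (c4 (exist _ a (memP a)) (exist _ c cB) (exist _ b bB) (exist _ d dB)).
Qed.

(** * Components of graphs of maximum degree two *)

Lemma isomorphic_ord (G : sgraph) n (e : rel 'I_n) (es : symmetric e) (ei : irreflexive e)
    (v : 'I_n -> G) :
  injective v -> (forall x, exists i, v i = x) -> (forall i j, adj (v i) (v j) = e i j) ->
  isomorphic G (SGraph es ei).
Proof.
move=> vI vS vA.
have v_codom x : x \in codom v by have [i <-] := vS x; apply: codom_f.
have vK x : v (iinv (v_codom x)) = x by apply: f_iinv.
exists (fun x => iinv (v_codom x)).
  by exists v => [x|i]; [apply: vK | apply: vI; apply: vK].
by move=> x y; rewrite -[in RHS](vK x) -[in RHS](vK y) vA.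
Qed.

Section Component.
Variable G : sgraph.
Hypothesis d2 : degree_le2 G.

(* [p] runs through a connected component, and [b] tells whether its last vertex is joined to
   the first one. *)
Definition component_seq (p : seq G) (b : bool) : Prop :=
  [/\ uniq p,
      sorted (@adj G) p,
      forall x y, x \in p -> adj x y -> y \in p
    & forall z i j, i < j < size p ->
        adj (nth z p i) (nth z p j) = (j == i.+1) || [&& b, i == 0 & j.+1 == size p]].

(* A longest path through [z] cannot be extended, and so by the degree bound it is a component. *)
Lemma exists_component_seq z : exists p b, z \in p /\ component_seq p b.
Proof.
pose Q n := [exists p : n.-tuple G, [&& uniq p, sorted (@adj G) p & z \in p]].
have QI (p : seq G) : uniq p -> sorted (@adj G) p -> z \in p -> Q (size p).
  by move=> Up Sp zp; apply/existsP; exists (in_tuple p); rewrite /= Up Sp zp.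
have Q1 : exists n, Q n by exists 1; apply: (QI [:: z]); rewrite // inE.
have Qmax n : Q n -> n <= #|G|.
  case/existsP=> p /and3P[Up _ _].
  by rewrite -(size_tuple p) -(card_uniqP Up) max_card.
have [p [Up Sp zp p_max]] : exists p : seq G,
    [/\ uniq p, sorted (@adj G) p, z \in p & forall m, Q m -> m <= size p].
  have [n /existsP[p /and3P[Up Sp zp]] p_max] := ex_maxnP Q1 Qmax.
  by exists p; rewrite size_tuple.
have nthI i j : i < size p -> j < size p -> (nth z p i == nth z p j) = (i == j).
  by move=> ip jp; rewrite nth_uniq.
have step i : i.+1 < size p -> adj (nth z p i) (nth z p i.+1) by move/(sortedP z): Sp; apply.
have first_end y : adj (nth z p 0) y -> y \in p.
  move=> py; apply/negPn/negP => yp.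
  suff /p_max : Q (size (y :: p)) by rewrite ltnn.
  apply: QI; rewrite /= ?yp // ?inE ?zp ?orbT //.
  by case: (p) py Sp => //= x s; rewrite adj_sym => ->.
have last_end y : adj (nth z p (size p).-1) y -> y \in p.
  move=> py; apply/negPn/negP => yp.
  suff /p_max : Q (size (rcons p y)) by rewrite size_rcons ltnn.
  apply: QI; rewrite ?rcons_uniq ?yp // ?mem_rcons ?inE ?zp ?orbT //.
  by case: (p) py Sp zp => //= x s; rewrite rcons_path nth_last /= => -> ->.
(* An inner vertex already has its two path neighbours, and the degree bound leaves no third. *)
have inner i y : 0 < i -> i.+1 < size p -> adj (nth z p i) y ->
    (nth z p i.-1 == y) || (nth z p i.+1 == y).
  case: i => // i _ ip py /=.
  have ip' := step _ (ltnW ip); rewrite adj_sym in ip'.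
  by have := d2 ip' (step _ ip) py; rewrite nthI ?(ltn_eqF (leqnSn i.+1)) //; lia.
(* The ends of a two-vertex path are adjacent without closing a cycle, hence the test on the
   size. *)
exists p, ((2 < size p) && adj (nth z p 0) (nth z p (size p).-1)); split=> //; split=> //.
  move=> x y /(nthP z)[i ip <-] xy.
  have [i0|i0] := posnP i; first by apply: first_end; rewrite -i0.
  have [iS|iS] := ltnP i.+1 (size p).
    by case/orP: (inner i y i0 iS xy) => /eqP <-; rewrite mem_nth // (leq_ltn_trans (leq_pred i)).
  have sp : i.+1 = size p by apply/eqP; rewrite eqn_leq ip iS.
  by apply: last_end; rewrite -sp.
move=> z0 i j /andP[ij jp].
have ip := ltn_trans ij jp.
rewrite !(set_nth_default z) //.
have [ji|jS] /= := eqVneq j i.+1; first by rewrite ji step // -ji.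
apply/idP/idP; last first.
  by case/and3P=> /andP[_ last_adj] /eqP-> /eqP jS'; rewrite -jS' in last_adj.
(* A chord can only join the first vertex to the last, since by [inner] an inner vertex is adjacent
   only to its path neighbours. *)
move=> adj_ij.
have i0 : i = 0.
  apply/eqP/negPn/negP; rewrite -lt0n => i0.
  have ip' : i.+1 < size p by apply: leq_ltn_trans jp.
  have := inner i _ i0 ip' adj_ij.
  by rewrite !nthI // ?(leq_ltn_trans (leq_pred i)) //; lia.
have jS' : j.+1 = size p.
  apply/eqP/negPn/negP => jp'.
  have jp'' : j.+1 < size p by rewrite ltn_neqAle jp' jp.
  rewrite adj_sym in adj_ij.
  have := inner j _ (leq_ltn_trans (leq0n i) ij) jp'' adj_ij.
  by rewrite !nthI // ?(leq_ltn_trans (leq_pred j)) //; lia.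
rewrite i0 jS' !eqxx !andbT; subst i; rewrite -jS' /= adj_ij andbT; lia.
Qed.

(** Both relations are symmetric and irreflexive, so comparing them for [i < j] suffices; the form
    required of [e] is that of the last clause of [component_seq]. *)
Lemma component_isomorphic p b (S : {set G}) (e : rel 'I_(size p))
    (es : symmetric e) (ei : irreflexive e) :
  component_seq p b -> S =i p ->
  (forall i j : 'I_(size p), i < j -> e i j = (j == i.+1 :> nat) || [&& b, i == 0 :> nat & j.+1 == size p]) ->
  isomorphic (induced S) (SGraph es ei).
Proof.
move=> [Up _ _ adjp] Sp eE.
have pS i : tnth (in_tuple p) i \in S by rewrite Sp mem_tnth.
have lt_adj (i j : 'I_(size p)) : i < j -> adj (tnth (in_tuple p) i) (tnth (in_tuple p) j) = e i j.
  move=> ij; set z := tnth _ i; rewrite eE // (tnth_nth z) /= -(adjp z) ?ij ?ltn_ord //.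
  by rewrite {1}/z (tnth_nth z).
pose v (i : 'I_(size p)) : induced S := exist (fun x => x \in S) _ (pS i).
apply: (@isomorphic_ord (induced S) _ _ es ei v).
- by move=> i j [] /(tuple_uniqP (in_tuple p) Up).
- case=> y yS; have := yS; rewrite Sp => /(tnthP (in_tuple p))[i yi].
  by exists i; apply: val_inj.
- move=> i j; rewrite /= /induced_adj /=.
  have [ij|ij|/val_inj ->] := ltngtP i j; first exact: lt_adj.
    by rewrite adj_sym es lt_adj.
  by rewrite adj_irrefl ei.
Qed.

(** A closed sequence of three vertices would be a triangle and one of four a square, so a cycle has
    at least five vertices. *)
Lemma component_path_or_cycle p b (S : {set G}) :
  triangle_free G -> square_free G -> 0 < size p -> component_seq p b -> S =i p ->
  is_path_graph (induced S) \/ is_cycle_graph_ge 5 (induced S).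
Proof.
move=> t3 c4 p0 comp Sp.
case: (boolP (b && (2 < size p))) => [/andP[bT p3]|closedF]; [right | left]; exists (size p) => //.
- case: (comp); rewrite bT; case: p p0 p3 {comp Sp} => [|x [|y [|z [|t [|u s]]]]] //= _ _.
    move=> _ _ _ A; case: (t3 x y z); first exact: (A x 0 1).
      exact: (A x 1 2).
    by rewrite adj_sym; apply: (A x 0 2).
  rewrite !inE !negb_or => /and4P[/and3P[_ xz _] /andP[_ yt] _ _] _ _ A.
  have := c4 x y z t (A x 0 1 _) (A x 1 2 _) (A x 2 3 _).
  rewrite adj_sym (negPf xz) (negPf yt) => F; apply/contraT => _.
  by apply: F => //; apply: (A x 0 3).
- apply: (component_isomorphic _ _ comp Sp) => i j ij.
  by rewrite cycle_adjE -val_eqE bT /=; have := ltn_ord j; lia.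
- apply: (component_isomorphic _ _ comp Sp) => i j ij.
  by rewrite /path_adj; have := ltn_ord j; lia.
Qed.

(** The blocks are the classes of [connect]. A component sequence through [z] contains the class of
    [z] because it is closed under adjacency, and stays inside it because it is a walk. *)
Lemma local_disjoint_cycles_and_paths :
  triangle_free G -> square_free G -> disjoint_cycles_and_paths 5 G.
Proof.
move=> t3 c4.
have conn_sym : connect_sym (@adj G) by apply: sym_connect_sym; apply: adj_sym.
have eqR : {in [set: G] & &, equivalence_rel (connect (@adj G))}.
  by move=> x y z _ _ _; split=> [|/(same_connect conn_sym)].
have partP := equivalence_partitionP eqR.
exists (equivalence_partition (connect (@adj G)) [set: G]); split=> //.
  move=> x y xy; apply/eqP; have [/eqP covP trivP _] := and3P partP.
  rewrite eq_pblock ?covP ?inE //.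
  by rewrite pblock_equivalence_partition ?inE // connect1.
move=> S /imsetP[z _ ->].
have [p [b [zp comp]]] := exists_component_seq z.
apply: (component_path_or_cycle t3 c4 _ comp); first by case: (p) zp.
case: comp => _ Sp clp _ y; rewrite !inE /=.
apply/idP/idP.
  case/connectP=> q zq ->.
  by elim: q z zp zq => //= w q IH z zp /andP[zw]; apply: IH; apply: clp zw.
case: p Sp zp {clp} => // x s /= xs zp yp.
have conn w : w \in x :: s -> connect (@adj G) x w by apply: path_connect.
by rewrite (same_connect conn_sym (_ : connect _ z x)) ?conn // conn_sym conn.
Qed.
End Component.

(** * Lower bound on the size of a cover *)

Lemma cover_degree (H : sgraph) (R : {set H}) (Ts : seq {set H}) x :
  degree_le2 (complement H) -> x \in R ->
  {in Ts, forall T : {set H}, #|T| <= 3} ->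
  {in R &, forall x y, adj x y -> exists2 T, T \in Ts & (x \in T) && (y \in T)} ->
  #|R| <= 3 + 2 * count (fun T : {set H} => x \in T) Ts.
Proof.
move=> d2 xR T3 cov.
pose N := [set y : complement H | @adj (complement H) x y].
have N2 : #|N| <= 2.
  rewrite leqNgt; apply/negP => /card_gt2P[a [b [c [[]]]]]; rewrite !inE => xa xb xc [ab bc ca].
  by have := d2 _ _ _ _ xa xb xc; rewrite (negPf ab) (negPf bc) eq_sym (negPf ca).
pose X (Us : seq {set H}) := [set y | has (fun T : {set H} => (x \in T) && (y \in T :\ x)) Us].
(* Besides [x] itself, [R] contains at most two neighbours of [x] in the complement, and vertices
   sharing a member of [Ts] with [x]; each such member brings at most two. *)
have sub : R \subset x |: (N :|: X Ts).
  apply/subsetP => y yR; rewrite !inE; have [//|yx] := eqVneq y x.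
  rewrite /= /compl_adj eq_sym yx /=; case: (boolP (adj x y)) => //= xy.
  have [T TT /andP[xT yT]] := cov x y xR yR xy.
  by apply/hasP; exists T; rewrite // !inE yx xT.
have cX (Us : seq {set H}) : {in Us, forall T : {set H}, #|T| <= 3} ->
    #|X Us| <= 2 * count (fun T : {set H} => x \in T) Us.
  elim: Us => [|T Us IH] U3; first by rewrite eq_card0 // => y; rewrite inE.
  have {}IH : #|X Us| <= 2 * count (fun T : {set H} => x \in T) Us.
    by apply: IH => V VU; apply: U3; rewrite inE VU orbT.
  have -> : X (T :: Us) = (if x \in T then T :\ x else set0) :|: X Us.
    by apply/setP=> y; rewrite !inE /=; case: (x \in T); rewrite !inE.
  rewrite /=; case: (boolP (x \in T)) => xT //=; last by rewrite set0U.
  rewrite (leq_trans (leq_card_setU _ _)) // mulnDr leq_add //.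
  by have := U3 T (mem_head _ _); rewrite (cardsD1 x) xT.
rewrite (leq_trans (subset_leq_card sub)) // cardsU1.
rewrite (leq_trans (leq_add (leq_b1 _) (leq_card_setU _ _))) //.
by rewrite -[3]/(1 + 2) -addnA leq_add2l leq_add ?cX.
Qed.

Lemma sum_count_cover (T : finType) (R : {set T}) (Ts : seq {set T}) n :
  {in Ts, forall U : {set T}, #|U| <= n} ->
  \sum_(x in R) count (fun U : {set T} => x \in U) Ts <= n * size Ts.
Proof.
elim: Ts => [|U Ts IH] Un /=; first by rewrite big1.
rewrite big_split mulnS leq_add //=.
  rewrite (eq_bigr (fun x => if x \in U then 1 else 0)) => [|x _]; last by case: (_ \in _).
  rewrite -big_mkcondr sum1dep_card (leq_trans _ (Un U (mem_head _ _))) //.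
  by apply/subset_leq_card/subsetP=> x; rewrite inE => /andP[].
by apply: IH => V VT; apply: Un; rewrite inE VT orbT.
Qed.

Lemma cover_lower_bound (H : sgraph) (R : {set H}) (Ts : seq {set H}) :
  degree_le2 (complement H) -> triangle_free (complement H) -> square_free (complement H) ->
  {in Ts, forall T : {set H}, #|T| <= 3} ->
  {in R &, forall x y, adj x y -> exists2 T, T \in Ts & (x \in T) && (y \in T)} ->
  3 <= #|R| -> #|R| < size Ts + 3.
Proof.
move=> d2 t3 c4 T3 cov R3; rewrite ltnNge; apply/negP => tR.
have compl (x y : complement H) : x \in R -> y \in R -> x != y ->
    (forall T, T \in Ts -> (x \in T) && (y \in T) = false) -> adj x y.
  move=> xR yR xy noT; rewrite /= /compl_adj xy /=; apply/negP => /(cov x y xR yR)[T TT].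
  by rewrite noT.
pose d x := count (fun T : {set H} => x \in T) Ts.
have deg x : x \in R -> #|R| <= 3 + 2 * d x by move=> xR; apply: cover_degree.
(* [(#|R| - 2)./2] is [(#|R| - 3) / 2] rounded up. Without rounding, [tR] would only give
   [#|R| <= 6]; the rounding excludes 4 and 6. *)
have avg : #|R| * (#|R| - 2)./2 <= 3 * size Ts.
  apply: leq_trans (sum_count_cover R T3).
  by rewrite -sum_nat_const leq_sum // => x /deg; rewrite /d; lia.
have /orP[/eqP R_3|/eqP R_5] : (#|R| == 3) || (#|R| == 5).
  have [|R6] := leqP #|R| 5; first by move: R3 tR avg; case: #|R| => [|[|[|[|[|[|]]]]]] //=; lia.
  have := leqnn (#|R| - 2)./2; nia.
- have Ts0 : Ts = [::] by apply/size0nil; lia.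
  have /card_gt2P[x [y [z [[xR yR zR] [xy yz zx]]]]] : 2 < #|R| by rewrite R_3.
  by apply: (t3 x y z); apply: compl => // T; rewrite Ts0.
have meetR x : x \in R -> has (fun T : {set H} => x \in T) Ts.
  by move=> /deg; rewrite has_count -/(d x); lia.
(* There are one or two sets; a single one is listed twice. *)
have [T1 [T2 TsE]] : exists T1 T2, Ts =i [:: T1; T2].
  have : size Ts <= 2 by lia.
  have : 0 < size Ts by lia.
  case: (Ts) => [|U [|V [|]]] // _ _; last by exists U, V.
  by exists U, U => T; rewrite !inE orbb.
have two U : U \in Ts -> exists a b : complement H, [/\ a \in R :\: U, b \in R :\: U & a != b].
  move=> UT; apply/card_gt1P; rewrite cardsD R_5 ltn_subRL addn1 !ltnS.
  by rewrite (leq_trans (subset_leq_card (subsetIr R U))) // T3.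
have other x : x \in R -> (x \in T1) || (x \in T2).
  by move=> /meetR/hasP[T]; rewrite TsE !inE => /orP[]/eqP-> ->; rewrite ?orbT.
have [|a [b [/setDP[aR aT] /setDP[bR bT] ab]]] := two T1; first by rewrite TsE !inE eqxx.
have [|c [e [/setDP[cR cT] /setDP[eR eT] ce]]] := two T2; first by rewrite TsE !inE eqxx orbT.
(* A vertex outside [T1] and one outside [T2] share no set, and they differ because every vertex of
   [R] is in [T1] or [T2]. Hence [a], [c], [b], [e] is a square of the complement. *)
have cross (x y : complement H) : x \in R -> y \in R -> x \notin T1 -> y \notin T2 -> adj x y.
  move=> xR yR xT yT; apply: compl => //.
    by apply: contraNneq xT => ->; have := other y yR; rewrite (negPf yT) orbF.
  by move=> T; rewrite TsE !inE => /orP[]/eqP->; rewrite ?(negPf xT) ?(negPf yT) ?andbF.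
have := c4 a c b e (cross _ _ aR cR aT cT).
by rewrite (adj_sym c) (adj_sym e) !cross // (negPf ab) (negPf ce) => /(_ isT isT isT).
Qed.

(** * Upper bounds from explicit covers *)

Section UpperBounds.
Variable H : sgraph.

(** The stars are centred at all vertices outside [U], so [Ts] only has to cover the edges inside
    [U]. *)
Lemma chromatic_number_cover (U : {set H}) (Ts : seq {set H}) :
  {in Ts, forall T : {set H}, #|T| <= 3} ->
  {in U &, forall x y, adj x y -> exists2 T, T \in Ts & (x \in T) && (y \in T)} ->
  chromatic_number (complement (line_graph H)) <= #|H| - #|U| + size Ts.
Proof.
move=> T3 cov; apply/chromatic_number_le/colorable_cover; exists (~: U), Ts; split=> //.
  by rewrite cardsCs setCK leqnn.
by rewrite setCK.
Qed.

Lemma card_uniq_set (T : finType) (s : seq T) : uniq s -> #|[set x in s]| = size s.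
Proof. by rewrite cardsE => /card_uniqP. Qed.

Lemma adjN_compl (x y : H) : @adj (complement H) x y -> adj x y -> False.
Proof. by case/andP=> _ /negP. Qed.

(** One 3-set takes the place of the stars at any three vertices. *)
Lemma chromatic_number_le_of_lt_card : 2 < #|H| ->
  chromatic_number (complement (line_graph H)) <= #|H| - 2.
Proof.
move=> H3; have /card_gt2P[x [y [z [_ [xy yz zx]]]]] : 2 < #|[set: H]| by rewrite cardsT.
have s3 : #|[set t in [:: x; y; z]]| = 3.
  by rewrite card_uniq_set //= !inE negb_or xy yz eq_sym zx.
apply: (@leq_trans (#|H| - 3 + 1)); last by lia.
rewrite -[in leqRHS]s3; apply: (chromatic_number_cover (Ts := [:: [set t in [:: x; y; z]]])).
  by move=> T; rewrite inE => /eqP->; rewrite s3.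
by move=> u v uS vS _; exists [set t in [:: x; y; z]]; rewrite ?mem_head ?uS.
Qed.

(** Among [x], [a], [b], [c], all edges of [H] lie inside [abc]. The bound on [#|H|] ensures that
    the truncated difference [#|H| - 3] is less than [#|H| - 2]. *)
Lemma chromatic_number_degree (x a b c : H) :
  @adj (complement H) x a -> @adj (complement H) x b -> @adj (complement H) x c ->
  a != b -> a != c -> b != c ->
  3 < #|H| /\ chromatic_number (complement (line_graph H)) <= #|H| - 3.
Proof.
move=> xa xb xc ab ac bc.
have s4 : #|[set t in [:: x; a; b; c]]| = 4.
  rewrite card_uniq_set //= !inE !negb_or ab ac bc.
  by rewrite (adj_neq xa) (adj_neq xb) (adj_neq xc).
have H4 : 3 < #|H| by rewrite -[4]s4 max_card.
split=> //; apply: (@leq_trans (#|H| - 4 + 1)); last by lia.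
rewrite -[in leqRHS]s4; apply: (chromatic_number_cover (Ts := [:: [set t in [:: a; b; c]]])).
  by move=> T; rewrite inE => /eqP->; rewrite card_uniq_set //= !inE !negb_or ab ac bc.
have notx t : t \in [:: x; a; b; c] -> adj x t -> False.
  rewrite !inE => /or4P[]/eqP->; [by rewrite adj_irrefl | exact: adjN_compl..].
move=> u v; rewrite !(inE, in_cons) => uS vS uv; exists [set t in [:: a; b; c]]; first exact: mem_head.
rewrite !inE; case: (eqVneq u x) uS => [ux _|ux /= uS].
  by rewrite ux in uv; case: (notx v); rewrite // !inE.
rewrite uS; case: (eqVneq v x) vS => [vx _|_ /= ->] //.
by rewrite vx adj_sym in uv; case: (notx u); rewrite // !inE uS orbT.
Qed.

Lemma chromatic_number_triangle (x y z : H) :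
  @adj (complement H) x y -> @adj (complement H) y z -> @adj (complement H) z x ->
  2 < #|H| /\ chromatic_number (complement (line_graph H)) <= #|H| - 3.
Proof.
move=> xy yz zx.
have s3 : #|[set t in [:: x; y; z]]| = 3.
  by rewrite card_uniq_set //= !inE negb_or (adj_neq xy) (adj_neq yz) eq_sym (adj_neq zx).
split; first by rewrite -[3]s3 max_card.
rewrite -[in leqRHS]s3 -[leqRHS]addn0; apply: (chromatic_number_cover (Ts := [::])) => //.
move=> u v; rewrite !inE => /or3P[]/eqP-> /or3P[]/eqP-> uv;
  by [rewrite adj_irrefl in uv
     | case: (adjN_compl xy); rewrite // adj_sym
     | case: (adjN_compl yz); rewrite // adj_sym
     | case: (adjN_compl zx); rewrite // adj_sym].
Qed.

(** Pairs between [ab] and [cd] are sides of the square, hence not edges of [H]; the other pairs lie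
    in [eab] or [ecd], so two sets replace five stars. *)
Lemma chromatic_number_square (a c b d e : H) :
  @adj (complement H) a c -> @adj (complement H) c b ->
  @adj (complement H) b d -> @adj (complement H) d a -> a != b -> c != d ->
  e \notin [:: a; b; c; d] ->
  4 < #|H| /\ chromatic_number (complement (line_graph H)) <= #|H| - 3.
Proof.
move=> ac cb bd da ab cd eS.
have [eab ecd] : e \notin [:: a; b] /\ e \notin [:: c; d].
  by move: eS; rewrite !inE !negb_or => /and4P[-> -> -> ->].
have s5 : #|[set t in [:: e; a; b; c; d]]| = 5.
  rewrite card_uniq_set //= eS !inE !negb_or ab cd (adj_neq ac) (adj_neq bd).
  by rewrite eq_sym (adj_neq da) eq_sym (adj_neq cb).
have H5 : 4 < #|H| by rewrite -[5]s5 max_card.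
split=> //; apply: (@leq_trans (#|H| - 5 + 2)); last by lia.
rewrite -[in leqRHS]s5.
apply: (chromatic_number_cover (Ts := [:: [set t in [:: e; a; b]]; [set t in [:: e; c; d]]])).
  move=> T; rewrite !inE => /orP[]/eqP->; rewrite card_uniq_set //= ?eab ?ecd !inE ?ab ?cd //.
have nadj u v : u \in [:: a; b] -> v \in [:: c; d] -> adj u v -> False.
  rewrite !inE => /orP[]/eqP-> /orP[]/eqP->; [exact: adjN_compl| | |exact: adjN_compl];
    by rewrite adj_sym; apply: adjN_compl.
have split5 t : t \in [set t in [:: e; a; b; c; d]] ->
    [\/ t = e, t \in [:: a; b] | t \in [:: c; d]].
  rewrite in_set in_cons -[[:: a; b; c; d]]/([:: a; b] ++ [:: c; d]) mem_cat.
  by case/predU1P=> [->|/orP[]]; [apply: Or31 | apply: Or32 | apply: Or33].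
move=> u v /split5 uS /split5 vS uv.
have [abT|cdT] : (u \in e :: [:: a; b]) && (v \in e :: [:: a; b]) \/
    (u \in e :: [:: c; d]) && (v \in e :: [:: c; d]).
  have inl s : e \in e :: s by apply: mem_head.
  have inr t s : t \in s -> t \in e :: s by rewrite in_cons => ->; rewrite orbT.
  case: uS vS => [ue|uS|uS] [ve|vS|vS]; rewrite ?ue ?ve ?inl ?(inr _ _ uS) ?(inr _ _ vS);
    by [left | right | case: (nadj u v) | case: (nadj v u); rewrite // adj_sym].
- by exists [set t in [:: e; a; b]]; rewrite ?mem_head ?in_set.
- by exists [set t in [:: e; c; d]]; rewrite ?in_set // in_cons mem_head orbT.
Qed.
End UpperBounds.

(** * The excluded 4-cycle and the equivalence *)

Lemma isomorphic_cycle4 (G : sgraph) (a c b d : G) :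
  degree_le2 G -> adj a c -> adj c b -> adj b d -> adj d a -> a != b -> c != d ->
  (forall e, e \in [:: a; b; c; d]) -> isomorphic G (cycle_graph 4).
Proof.
move=> d2 ac cb bd da ab cd all_abcd.
(* A vertex of the square has two neighbours on it, so the degree bound rules out the diagonals [ab]
   and [cd]. *)
have nadj (u v w t : G) : adj u v -> adj u w ->
    v != w -> v != t -> w != t -> adj u t = false.
  move=> uv uw vw vt wt; apply/negP => ut; have := d2 _ _ _ _ uv uw ut.
  by rewrite (negPf vw) (negPf vt) (negPf wt).
pose v (i : 'I_4) : G := tnth [tuple a; c; b; d] i.
apply: (@isomorphic_ord G _ _ _ _ v).
- apply/tuple_uniqP; rewrite /= !inE !negb_or ab cd (adj_neq ac) (adj_neq cb) (adj_neq bd).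
  by rewrite eq_sym (adj_neq da).
- move=> x; have /tnthP[i xi] : x \in [tuple a; c; b; d].
    by move: (all_abcd x); rewrite !inE; do !case: (_ == _).
  by exists i.
have ab0 : adj a b = false.
  by apply: (nadj _ c d) => //; rewrite 1?[d == b]eq_sym ?(adj_neq cb) ?(adj_neq bd) // adj_sym.
have cd0 : adj c d = false.
  have ad : a != d by rewrite eq_sym (adj_neq da).
  by apply: (nadj _ b a) => //; rewrite 1?[b == a]eq_sym ?(adj_neq bd) // adj_sym.
move=> i j; rewrite cycle_adjE -val_eqE /v !(tnth_nth a).
case: i j => [[|[|[|[|]]]] // ip] [[|[|[|[|]]]] // jp] /=.
all: rewrite ?adj_irrefl ?ab0 ?cd0 ?ac ?cb ?bd ?da // adj_sym.
all: by rewrite ?ab0 ?cd0 ?ac ?cb ?bd ?da.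
Qed.

Theorem theorem5 (H : sgraph)
  (H_not_small_complete : forall n, n <= 2 -> ~ isomorphic H (complete_graph n))
  (H_not_2K2 : ~ isomorphic (complement H) (cycle_graph 4)) :
  chromatic_number (complement (line_graph H)) = #|H| - 2 <->
  disjoint_cycles_and_paths 5 (complement H).
Proof.
split=> [chi|/disjoint_cycles_and_paths_local[d2 t3 c4]].
  have d2 : degree_le2 (complement H).
    move=> x a b c xa xb xc; apply/negPn/negP; rewrite !negb_or => /and3P[ab ac bc].
    by have := chromatic_number_degree xa xb xc ab ac bc; rewrite chi; lia.
  apply: (local_disjoint_cycles_and_paths d2).
    by move=> x y z xy yz zx; have := chromatic_number_triangle xy yz zx; rewrite chi; lia.
  move=> a c b d ac cb bd da; apply/negPn/negP; rewrite negb_or => /andP[ab cd].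
  (* A fifth vertex would save a colour; without one the complement is the 4-cycle excluded by
     [H_not_2K2]. *)
  have all_abcd e : e \in [:: a; b; c; d].
    apply/negPn/negP => eN.
    by have := chromatic_number_square ac cb bd da ab cd eN; rewrite chi; lia.
  by apply: H_not_2K2; apply: isomorphic_cycle4 d2 ac cb bd da ab cd all_abcd.
(* In this range [#|H| - 2] truncates to 0, and a graph with an edge would be the complete graph on
   two vertices, which is excluded. *)
have small : #|H| <= 2 -> chromatic_number (complement (line_graph H)) = 0.
  move=> H2; case: (pickP (fun p : H * H => adj p.1 p.2)) => [[x y] /= xy|noE].
    case: (H_not_small_complete _ (leqnn 2)).
    pose v (i : 'I_2) : H := tnth [tuple x; y] i.
    have Uxy : uniq [:: x; y] by rewrite /= inE (adj_neq xy).
    have all_xy z : z \in [:: x; y].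
      apply/negPn/negP => zN; have : uniq (z :: [:: x; y]) by rewrite cons_uniq zN.
      by move/card_uniqP => cz; have := max_card (mem [:: z; x; y]); rewrite cz leqNgt ltnS H2.
    apply: (@isomorphic_ord H _ _ _ _ v); first by apply/tuple_uniqP.
      by move=> z; have /tnthP[i] := all_xy z : z \in [tuple x; y]; exists i.
    move=> [[|[|]] // ip] [[|[|]] // jp]; rewrite /v !(tnth_nth x) /= ?adj_irrefl ?xy //.
    by rewrite adj_sym xy.
  apply/eqP; rewrite -leqn0; apply/chromatic_number_le/colorable_cover.
  exists set0, [::]; rewrite cards0; split=> // x y _ _ xy.
  by have := noE (x, y); rewrite /= xy.
apply/eqP; rewrite eqn_leq; have [H2|H3] := leqP #|H| 2; first by rewrite small //; lia.
rewrite chromatic_number_le_of_lt_card //=.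
have /colorable_cover[S [Ts [le_chi T3 cov]]] := colorable_chromatic_number (complement (line_graph H)).
rewrite leqNgt; apply/negP; rewrite -(cardsC S) => lt_chi.
(* Fewer than [#|H| - 2] colours means [size Ts + 3 <= #|~: S|], which contradicts the lower
   bound. *)
have R3 : 3 <= #|~: S| by lia.
by have := cover_lower_bound d2 t3 c4 T3 cov R3; lia.
Qed.
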